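(* Let $\Gamma$ be a finite Abelian group with $|\Gamma|=n$, let $S$ be a symmetric multiset of elements of $\Gamma$ with $|S|=d$, and let $G=\mathrm{Cay}(\Gamma,S)$. Let $0<\epsilon\le 1$ and $\tau = 100\, d\, \phi(G)^2/\epsilon^2$. Then for every $Q\subseteq \Gamma$ with $1\le |Q|\le n/2$ and $\phi_G(Q)\le 2\phi(G)$, $$\|\Pi_{\mathrm{LOW}_\tau(G)}\, \bar{\mathbf{1}}_Q\|^2 \ge (1-\epsilon)\,\|\bar{\mathbf{1}}_Q\|^2.$$
   Context: A multiset $S$ of elements of $\Gamma$ is symmetric if $x$ and $-x$ have equal multiplicity for all $x$. $\mathrm{Cay}(\Gamma,S)$ has vertex set $\Gamma$ and an edge $(v,v+s)$ for every $v$ and every element $s$ of $S$ (with multiplicity). $\phi_G(Q)=|\partial Q|/(d|Q|)$ where $\partial Q$ is the multiset of edges from $Q$ to its complement, and $\phi(G)=\min\{\phi_G(Q):1\le|Q|\le n/2\}$. The normalized Laplacian is $\mathbf{L}=I-\mathbf{A}$ ($\mathbf{A}$ the normalized adjacency matrix). $\mathrm{LOW}_\tau(G)$ is the span of all eigenvectors of $\mathbf{L}$ with eigenvalue at most $\tau$ (the whole space if $\tau\ge2$), and $\Pi_W$ denotes orthogonal projection onto $W$. $\mathbf{1}_Q$ is the indicator vector of $Q$ and $\bar x = x-\frac{\langle x,\mathbf 1\rangle}{n}\mathbf 1$. *)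

(* Defs.v *)
From HB Require Import structures.
From mathcomp Require Import all_boot all_order all_algebra.
From mathcomp Require Import polyrcf.
From mathcomp Require Import reals.
Set Implicit Arguments. Unset Strict Implicit. Unset Printing Implicit Defensive.
Import Order.TTheory GRing.Theory Num.Theory.
Local Open Scope ring_scope.

Section CayleyDefs.
Variables (R : realType) (G : finZmodType).
(* S : a multiset of elements of G, represented as a sequence (order irrelevant). *)
Variable S : seq G.

Definition symmetric_mset := forall x : G, count_mem x S = count_mem (- x) S.

Definition deg : nat := size S.

(* vertices of Cay(G,S) are indexed by 'I_#|G| through enum_val *)
Local Notation n := #|G|.

Definition adjmx : 'M[R]_n :=
  \matrix_(i, j) (count (fun s : G => (enum_val i + s)%R == enum_val j) S)%:R.

(* normalized adjacency matrix (the graph is deg-regular) *)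
Definition nadjmx : 'M[R]_n := (deg%:R)^-1 *: adjmx.

Definition nlapmx : 'M[R]_n := 1%:M - nadjmx.

Definition boundary_size (Q : {set G}) : nat :=
  \sum_(v in Q) count (fun s : G => (v + s)%R \notin Q) S.

Definition cond_set (Q : {set G}) : R :=
  (boundary_size Q)%:R / (deg * #|Q|)%:R.

Definition admissible (Q : {set G}) : bool := (1 <= #|Q|)%N && (2 * #|Q| <= n)%N.

(* phi(G) = min { phi_G(Q) : 1 <= |Q| <= n/2 } (0 if there is no such Q) *)
Definition conductance : R :=
  match [pick Q0 | admissible Q0] with
  | Some Q0 => \big[Num.min/cond_set Q0]_(Q | admissible Q) cond_set Q
  | None => 0
  end.

(* LOW_tau(G): span of all eigenvectors of L with eigenvalue <= tau
   (the eigenvalues of L are the real roots of its characteristic polynomial);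
   the whole space if tau >= 2. Row-vector convention (v *m L = lam *: v);
   L is symmetric. *)
Definition LOW (tau : R) : 'M[R]_n :=
  if 2 <= tau then 1%:M
  else (\sum_(lam <- rootsR (char_poly nlapmx) | (lam <= tau)%R) eigenspace nlapmx lam)%MS.

End CayleyDefs.

Definition orth_proj (R : realType) (m : nat) (W : 'M[R]_m) (x : 'rV[R]_m) : 'rV[R]_m :=
  let B := row_base W in x *m (B^T *m invmx (B *m B^T) *m B).

Definition sqnorm (R : realType) (m : nat) (x : 'rV[R]_m) : R := \sum_i x 0 i ^+ 2.

Definition indic (R : realType) (G : finType) (Q : {set G}) : 'rV[R]_#|G| :=
  \row_i (enum_val i \in Q)%:R.

Definition center (R : realType) (m : nat) (x : 'rV[R]_m) : 'rV[R]_m :=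
  x - ((\sum_i x 0 i) / m%:R) *: const_mx 1.

(* Main.v *)
(** The translations by elements of [Gamma] commute, so the displacement of an
    [N]-step lazy walk only depends on the net number [k_j] of uses of each
    generator [s_j], and [k_j] has variance [N p / d]. The function
    [b x = #|{v in Q | v + x notin Q}|] is even and subadditive, so moving by
    [sum_j k_j s_j] pushes at most [sum_j |k_j| b (s_j)] elements out of [Q], on
    average at most [sqrt (N p / d) * boundary_size S Q]. For [K = (1 - p L)^N]
    this bounds the energy [<x, (1 - K) x>] of the centred indicator [x] of [Q].
    On eigenvectors of [L] with eigenvalue above [tau = 1 / (N p)], [K] is at most
    [1 / 2], so twice the energy bounds the mass of [x] outside [LOW tau]. *)

Require Import Defs.
From HB Require Import structures.
From mathcomp Require Import all_boot all_order all_algebra.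
From mathcomp Require Import polyrcf complex spectral sesquilinear ring lra.
From mathcomp Require Import boolp reals.
Set Implicit Arguments. Unset Strict Implicit. Unset Printing Implicit Defensive.
Import Order.TTheory GRing.Theory Num.Theory.
Local Open Scope ring_scope.

(** * Squared norms and orthogonal projection *)

Lemma sqnormE (R : realType) n (x : 'rV[R]_n) : sqnorm x = (x *m x^T) 0 0.
Proof. by rewrite mxE; apply: eq_bigr => i _; rewrite mxE expr2. Qed.

Lemma sqnorm_ge0 (R : realType) n (x : 'rV[R]_n) : 0 <= sqnorm x.
Proof. by apply: sumr_ge0 => i _; apply: sqr_ge0. Qed.

Lemma sqnorm_eq0 (R : realType) n (x : 'rV[R]_n) : sqnorm x = 0 -> x = 0.
Proof.
move=> /eqP; rewrite psumr_eq0 => [/allP x0|i _]; last exact: sqr_ge0.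
apply/rowP => i; rewrite mxE.
by have /= := x0 i (mem_index_enum i); rewrite sqrf_eq0 => /eqP.
Qed.

(** If [u B B^T = 0] then [u B] has squared norm 0, so [u = 0]. Thus [invmx] in [orth_proj] is a
    true inverse. *)
Lemma gram_unit (R : realType) m n (B : 'M[R]_(m, n)) :
  row_free B -> B *m B^T \in unitmx.
Proof.
move=> /row_free_inj Binj; rewrite -row_free_unit -kermx_eq0.
apply/eqP/row_matrixP => i; rewrite row0.
set u := row i _; have uBB : u *m (B *m B^T) = 0.
  by apply/sub_kermxP; rewrite row_sub.
apply: Binj; rewrite mul0mx; apply: sqnorm_eq0.
by rewrite sqnormE trmx_mul mulmxA -(mulmxA u) uBB mul0mx mxE.
Qed.

(** With [P] the symmetric idempotent of [orth_proj] and [e = x - x P], the left side is [|e|^2]. As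
    [x - z = e + (x - z) P] with orthogonal summands, Pythagoras applies. *)
Lemma orth_proj_dist (R : realType) n (W : 'M[R]_n) (x z : 'rV[R]_n) :
  (z <= W)%MS -> sqnorm x - sqnorm (orth_proj W x) <= sqnorm (x - z).
Proof.
rewrite /orth_proj -(eq_row_base W) => /submxP[u ->].
move: (row_base W) (row_base_free W) u => B Bfree u; set P := B^T *m _ *m B.
have Bu := gram_unit Bfree.
have PT : P^T = P.
  by rewrite /P !trmx_mul trmxK trmx_inv trmx_mul trmxK mulmxA.
have BP : B *m P = B by rewrite /P !mulmxA mulmxV // mul1mx.
have PP : P *m P = P by rewrite {1}/P -mulmxA BP.
have [e eE] : exists e, e = x - x *m P by eexists.
have orthP (y : 'rV_n) : e *m (y *m P)^T = 0.
  by rewrite trmx_mul PT mulmxA eE mulmxBl -(mulmxA x P P) PP subrr mul0mx.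
have pyth (y : 'rV_n) : sqnorm (e + y *m P) = sqnorm e + sqnorm (y *m P).
  rewrite !sqnormE [(_ + _)^T]linearD /= mulmxDr !mulmxDl orthP add0r.
  have -> : y *m P *m e^T = 0.
    by apply: trmx_inj; rewrite trmx_mul trmxK orthP trmx0.
  by rewrite addr0 [LHS]mxE.
have := pyth x; rewrite {1}eE subrK => ->; rewrite addrK.
have -> : x - u *m B = e + (x - u *m B) *m P.
  by rewrite eE mulmxBl -(mulmxA u) BP addrA subrK.
by rewrite pyth lerDl sqnorm_ge0.
Qed.

(** * Polynomials in a real symmetric matrix *)

Section Spectral.
Variables (R : realType) (n : nat) (L : 'M[R]_n.+1).
Hypothesis LT : L^T = L.

(* Diagonalise [L] by a unitary matrix over [R[i]]; its eigenvalues are real. *)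
Lemma horner_mx_ge0 (r : {poly R}) (x : 'rV[R]_n.+1) :
  (forall lam, root (char_poly L) lam -> 0 <= r.[lam]) ->
  0 <= (x *m horner_mx L r *m x^T) 0 0.
Proof.
move=> r_ge0; pose toC : {rmorphism R -> R[i]%C} := real_complex R.
pose A := map_mx toC L.
have Areal : A \is a mxOver Num.real.
  by apply/mxOverP => i j; rewrite mxE complex_real.
have Aherm : A \is hermsymmx.
  apply: realsym_hermsym => //; apply/is_hermitianmxP.
  by rewrite expr0 scale1r map_mx_id // /A map_trmx LT.
have /mxOverP Dreal := hermitian_spectral_diag_real Aherm.
have /orthomx_spectralP := hermitian_normalmx Aherm.
set U := spectralmx A; set D := spectral_diag A => A_eq.
have Uun : U \is unitarymx by apply: spectral_unitarymx.
have Uunit : U \in unitmx by apply: spectral_unit.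
(* Row [i] of [U] is an eigenvector for the [i]-th diagonal entry. *)
have Droot i : exists2 lam, D 0 i = toC lam & root (char_poly L) lam.
  have /complex_realP[lam Dlam] := Dreal 0 i; exists lam => //.
  rewrite -(fmorph_root toC) map_char_poly -eigenvalue_root_char -/A.
  rewrite -[toC lam]Dlam.
  apply/eigenvalueP; exists (row i U); last first.
    apply: contraTneq Uunit => Ui0; rewrite -row_free_unit.
    apply/negP => /row_free_inj inj; have := inj 1%N (delta_mx 0 i) 0.
    rewrite -rowE Ui0 mul0mx => /(_ erefl) /matrixP /(_ 0 i).
    by rewrite !mxE !eqxx => /eqP; rewrite oner_eq0.
  rewrite -row_mul {1}A_eq !mulmxA mulmxV // mul1mx row_mul.
  by rewrite row_diag_mx -scalemxAl -rowE.
rewrite -(lecR 0) -[X in _ <= X]/(toC _).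
have -> : toC ((x *m horner_mx L r *m x^T) 0 0) =
  (map_mx toC (x *m horner_mx L r *m x^T)) 0 0 by rewrite [RHS]mxE.
rewrite !map_mxM map_horner_mx -/A A_eq horner_mx_uconjC //.
rewrite horner_mx_diag invmx_unitary //.
rewrite !mulmxA; set y := map_mx toC x *m map_mx _ _.
have -> : map_mx toC x^T = map_mx Num.conj (map_mx toC x)^T.
  by apply/matrixP => i j; rewrite !mxE conj_Creal ?complex_real.
rewrite -(mulmxA _ U).
have -> : U *m map_mx Num.conj (map_mx toC x)^T = map_mx Num.conj y^T.
  by rewrite /y trmx_mul map_mxM trmxCK.
(* In the eigenbasis the form is the sum of [r(lam_i) |y_i|^2]. *)
rewrite mxE sumr_ge0 // => i _.
rewrite mul_mx_diag !mxE mulrAC mulr_ge0 ?mul_conjC_ge0 //.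
have [lam -> /r_ge0] := Droot i.
by rewrite horner_map /= -(lecR 0).
Qed.

Lemma horner_mx_sym (r : {poly R}) : (horner_mx L r)^T = horner_mx L r.
Proof.
elim/poly_ind: r => [|r c IHr]; first by rewrite rmorph0 trmx0.
rewrite rmorphD rmorphM /= horner_mx_X horner_mx_C linearD /= tr_scalar_mx.
by rewrite trmx_mul IHr LT; congr (_ + _); apply: comm_mx_horner.
Qed.

(** [|x r(L)|^2] is the form of [r^2], and [- r^2] vanishes on the spectrum, so this norm is at most
    0. *)
Lemma mul_row_horner_mx_eq0 (r : {poly R}) (x : 'rV[R]_n.+1) :
  (forall lam, root (char_poly L) lam -> r.[lam] = 0) ->
  x *m horner_mx L r = 0.
Proof.
move=> r0; apply: sqnorm_eq0; apply/eqP; rewrite eq_le sqnorm_ge0 andbT.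
rewrite sqnormE trmx_mul horner_mx_sym mulmxA -(mulmxA x).
rewrite -[_ *m horner_mx L r](rmorphM (horner_mx L)) /= -oppr_ge0.
have -> : forall M : 'M[R]_1, - M 0 0 = (- M) 0 0 by move=> M; rewrite mxE.
rewrite -mulNmx -mulmxN -rmorphN; apply: horner_mx_ge0 => lam /r0.
by rewrite hornerN hornerM => ->; rewrite mul0r oppr0.
Qed.

End Spectral.

(** * Filtering by powers of [1 - p L] *)

Lemma iter_horner_mx (R : realType) n (L : 'M[R]_n.+1) (p : R) N (x : 'rV[R]_n.+1) :
  iter N (fun y => y - p *: (y *m L)) x =
  x *m horner_mx L ((1 - p *: 'X) ^+ N).
Proof.
elim: N => [|N IHN] /=; first by rewrite expr0 rmorph1 mulmx1.
rewrite IHN exprS mulrC rmorphM /= [_ * _ in RHS]/(_ *m _) mulmxA.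
rewrite rmorphB rmorph1 /= horner_mxZ horner_mx_X mulmxBr mulmx1.
by rewrite scalemxAr.
Qed.

(** Bernoulli gives [(1 + u)^N >= 2], while [(1 - u)^N (1 + u)^N = (1 - u^2)^N <= 1]. *)
Lemma pow_1sub_le_half (R : realFieldType) (u : R) N :
  0 <= u -> u <= 1 -> 1 <= u *+ N -> 2 * (1 - u) ^+ N <= 1.
Proof.
move=> u0 u1 Nu.
have bern : 1 + u *+ N <= (1 + u) ^+ N.
  elim: N {Nu} => [|N IHN]; first by rewrite mulr0n addr0 expr0.
  rewrite exprS; apply: le_trans (ler_wpM2l _ IHN); last by lra.
  have : 0 <= u * u *+ N by rewrite mulrn_wge0 ?mulr_ge0.
  rewrite mulrSr -mulrnAr; nra.
have uN0 : 0 <= (1 - u) ^+ N by rewrite exprn_ge0 ?subr_ge0.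
have : (1 - u) ^+ N * (1 + u) ^+ N <= 1.
  by rewrite -exprMn exprn_ile1 //; nra.
nra.
Qed.

(** The Lagrange basis polynomial at [lam], in a sigma type so that it can be extracted as data. *)
Lemma interpolation_indicator (R : fieldType) (rs : seq R) (lam : R) :
  uniq rs -> lam \in rs ->
  {l : {poly R} | forall mu, mu \in rs -> l.[mu] = (mu == lam)%:R}.
Proof.
move=> urs lam_rs.
exists (\prod_(mu <- rs | mu != lam) ((lam - mu)^-1 *: ('X - mu%:P))) => mu mu_rs.
rewrite horner_prod; have [->|mu_lam] := eqVneq mu lam.
  rewrite big1 // => nu nu_lam.
  by rewrite hornerZ hornerXsubC mulVf // subr_eq0 eq_sym.
apply/eqP; rewrite prodf_seq_eq0; apply/hasP; exists mu => //.
by rewrite mu_lam hornerZ hornerXsubC subrr mulr0 eqxx.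
Qed.

(** Take [z = x q(L)] with [q] equal to the indicator of [lam <= tau] on the spectrum. Then
    [|x - z|^2] is the form of [(1 - q)^2], which is at most [2 (1 - (1 - p lam)^N)] at every
    eigenvalue. *)
Lemma low_eigenspaces_dist (R : realType) n (L : 'M[R]_n) (tau p : R) N
    (x : 'rV[R]_n) :
  L^T = L ->
  (forall lam, eigenvalue L lam ->
     [/\ 0 <= p * lam, p * lam <= 1 & tau < lam -> 1 <= p * lam *+ N]) ->
  sqnorm x - sqnorm (orth_proj (\sum_(lam <- rootsR (char_poly L) |
                                  (lam <= tau)%R) eigenspace L lam)%MS x) <=
    2 * ((x - iter N (fun y => y - p *: (y *m L)) x) *m x^T) 0 0.
Proof.
case: n => [|n] in L x *.
  by rewrite /sqnorm !big_ord0 mxE big_ord0 subr0 mulr0.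
move=> LT eigL; set rs := rootsR (char_poly L).
set W := (\sum_(lam <- _ | _) _)%MS.
have cp0 : char_poly L != 0 by rewrite monic_neq0 // char_poly_monic.
have rsE lam : root (char_poly L) lam = (lam \in rs).
  by have := roots_on_rootsR cp0 lam; rewrite in_itv /= => ->.
have urs : uniq rs by apply: uniq_roots.
(* The match supplies the membership proof that interpolation needs; outside [rs] the default is
   0. *)
pose l lam := if lam \in rs =P true is ReflectT lamrs
  then sval (interpolation_indicator urs lamrs) else 0.
have lE lam mu : lam \in rs -> mu \in rs -> (l lam).[mu] = (mu == lam)%:R.
  move=> lamrs murs; rewrite /l; case: eqP => // lamrs'.
  by case: interpolation_indicator => /= q ->.
pose q := \sum_(lam <- rs | lam <= tau) l lam.
have qE mu : mu \in rs -> q.[mu] = (mu <= tau)%R%:R.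
  move=> murs; rewrite horner_sum big_mkcond (bigD1_seq mu) //= lE // eqxx.
  rewrite big_seq_cond big1 => [|lam /andP[lamrs lam_mu]].
    by rewrite addr0; case: ifP.
  by rewrite lE // eq_sym (negPf lam_mu) if_same.
have zW : (x *m horner_mx L q <= W)%MS.
  rewrite rmorph_sum /= mulmx_sumr big_seq_cond.
  apply: summx_sub => lam /andP[lamrs le_lam].
  rewrite /W [X in (_ <= X)%MS]big_mkcond (bigD1_seq lam) //= le_lam.
  apply: submx_trans (addsmxSl _ _); apply/eigenspaceP/eqP.
  rewrite -subr_eq0 -mul_mx_scalar -mulmxBr -mulmxA -(horner_mx_C L).
  rewrite -{2}[L]horner_mx_X -rmorphB -[horner_mx L _ *m _](rmorphM (horner_mx L)) /=.
  (* [l lam] times [X - lam] vanishes on the spectrum, so [x] times [l lam] at [L] lies in the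
     [lam]-eigenspace. *)
  apply/eqP/mul_row_horner_mx_eq0 => // mu; rewrite rsE => murs.
  rewrite hornerM lE // hornerXsubC.
  by case: eqP => [->|_]; rewrite ?subrr ?mulr0 ?mul0r.
apply: le_trans (orth_proj_dist x zW) _.
rewrite iter_horner_mx sqnormE.
set k := (1 - p *: 'X) ^+ N.
have subE r : x - x *m horner_mx L r = x *m horner_mx L (1 - r).
  by rewrite rmorphB rmorph1 mulmxBr mulmx1.
rewrite !subE trmx_mul horner_mx_sym // mulmxA -(mulmxA x).
rewrite -[horner_mx L _ *m horner_mx L _](rmorphM (horner_mx L)) /= -subr_ge0.
have -> : forall M M' : 'M[R]_1, 2 * M 0 0 - M' 0 0 = (2 *: M - M') 0 0.
  by move=> M M'; rewrite !mxE.
rewrite scalemxAl scalemxAr -horner_mxZ -mulmxBl -mulmxBr -rmorphB.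
apply: horner_mx_ge0 => // mu mu_root.
have murs : mu \in rs by rewrite -rsE.
have [] := eigL mu; first by rewrite eigenvalue_root_char.
move=> pmu_ge0 pmu_le1 high.
rewrite !hornerE qE //.
have [le_mu|gt_mu] := leP mu tau; rewrite /= ?(subrr, mul0r, subr0, mul1r).
  have : (1 - p * mu) ^+ N <= 1 by rewrite exprn_ile1 //; lra.
  by lra.
have := pow_1sub_le_half pmu_ge0 pmu_le1 (high gt_mu).
by lra.
Qed.

(** * Lazy walks on abelian groups *)

Section LazyWalk.
Variable R : realType.

(* One step of the walk that moves by a uniformly random [+- e j] with
   probability [p] and otherwise stays put. *)
Definition lazy_step (V : zmodType) d (e : 'I_d -> V) (p : R) (h : V -> R) : V -> R :=
  fun x => h x + p / (2 * d%:R) * \sum_j (h (x + e j) + h (x - e j) - 2 * h x).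

Lemma lazy_step_affine (V : zmodType) d (e : 'I_d -> V) p (a c : R) (h : V -> R) :
  lazy_step e p (fun x => a * h x + c) = fun x => a * lazy_step e p h x + c.
Proof.
apply/funext => x; rewrite /lazy_step /= [a * (h x + _)]mulrDr addrAC; congr (_ + _ + _).
rewrite [RHS]mulrCA; congr (_ * _); rewrite mulr_sumr; apply: eq_bigr => j _.
ring.
Qed.

Lemma iter_lazy_step_affine (V : zmodType) d (e : 'I_d -> V) p N (a c : R) (h : V -> R) :
  iter N (lazy_step e p) (fun x => a * h x + c) =
  fun x => a * iter N (lazy_step e p) h x + c.
Proof. by elim: N => // N /= ->; rewrite lazy_step_affine. Qed.

(** Used to lift a walk to [Z^d], where coordinates separate. *)
Lemma iter_lazy_step_comp (V W : zmodType) (f : {additive V -> W}) d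
    (e : 'I_d -> V) p N (h : W -> R) x :
  iter N (lazy_step e p) (h \o f) x = iter N (lazy_step (f \o e) p) h (f x).
Proof.
elim: N x => //= N IHN x; rewrite {1}/lazy_step [in RHS]/lazy_step !IHN.
congr (_ + _ * _); apply: eq_bigr => j _.
by rewrite !IHN raddfD raddfB.
Qed.

Lemma iter_lazy_step_shift (V : zmodType) d (e : 'I_d -> V) p N (h : V -> R) v x :
  iter N (lazy_step e p) (fun y => h (v + y)) x = iter N (lazy_step e p) h (v + x).
Proof.
elim: N x => //= N IHN x; rewrite {1}/lazy_step [in RHS]/lazy_step !IHN.
congr (_ + _ * _); apply: eq_bigr => j _.
by rewrite !IHN !addrA.
Qed.

Lemma iter_lazy_step_sum (V : zmodType) d (e : 'I_d -> V) p N (I : finType)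
    (P : pred I) (h : I -> V -> R) x :
  iter N (lazy_step e p) (fun y => \sum_(i | P i) h i y) x =
  \sum_(i | P i) iter N (lazy_step e p) (h i) x.
Proof.
elim: N x => //= N IHN x; rewrite {1}/lazy_step !IHN.
rewrite [RHS]big_split /= -mulr_sumr; congr (_ + _ * _).
rewrite exchange_big /=; apply: eq_bigr => j _.
by rewrite !IHN mulr_sumr -big_split -sumrB.
Qed.

(** A step is a combination with nonnegative weights, since [0 <= p <= 1]. *)
Lemma iter_lazy_step_le (V : zmodType) d (e : 'I_d -> V) p N (h h' : V -> R) x :
  0 <= p <= 1 -> (forall y, h y <= h' y) ->
  iter N (lazy_step e p) h x <= iter N (lazy_step e p) h' x.
Proof.
move=> /andP[p0 p1] hh'; elim: N x => //= N IHN x.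
set g := iter N _ h in IHN *; set g' := iter N _ h' in IHN *.
have stepE k : lazy_step e p k x =
    k x * (1 - (p / (2 * d%:R)) * (2 * d%:R))
    + p / (2 * d%:R) * \sum_j (k (x + e j) + k (x - e j)).
  rewrite /lazy_step sumrB sumr_const card_ord -mulr_natr; ring.
have pd0 : 0 <= p / (2 * d%:R) by rewrite divr_ge0 ?mulr_ge0.
rewrite !stepE lerD //.
  apply: ler_wpM2r => //; rewrite subr_ge0.
  (* The weight at [x] is 1 if [d = 0], and [1 - p] otherwise. *)
  have [->|d0] := eqVneq (2 * d%:R : R) 0; first by rewrite mulr0.
  by rewrite divfK.
by apply: ler_wpM2l => //; apply: ler_sum => j _; rewrite lerD.
Qed.

(** Since [(m + 1)^2 + (m - 1)^2 - 2 m^2 = 2], each step adds the constant [p / d * \sum_i c i]. *)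
Lemma iter_lazy_step_sqr d p N (c : 'I_d -> R) (C : R) (k : {ffun 'I_d -> int}) :
  iter N (lazy_step (fun j => [ffun i => (i == j)%:Z]) p)
    (fun k => \sum_i c i * (k i)%:~R ^+ 2 + C) k =
  \sum_i c i * (k i)%:~R ^+ 2 + C + N%:R * (p / d%:R) * \sum_i c i.
Proof.
elim: N k => [|N IHN] k /=; first by rewrite !mul0r addr0.
rewrite {1}/lazy_step; set q := iter N _ _ in IHN *.
have qE j : q (k + [ffun i => (i == j)%:Z]) + q (k - [ffun i => (i == j)%:Z])
    - 2 * q k = 2 * c j.
  rewrite !IHN.
  set T := \sum_i c i; set A := \sum_i _; set B := \sum_i _; set D := \sum_i c i * (k i)%:~R ^+ 2.
  suff : A + B - 2 * D = 2 * c j by lra.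
  rewrite /A /B /D mulr_sumr -big_split -sumrB /= (bigD1 j) //= !ffunE eqxx.
  rewrite big1 => [|i /negPf ij]; last by rewrite !ffunE ij /= ?oppr0 !addr0; ring.
  by rewrite addr0 rmorphD rmorphB /=; ring.
rewrite (eq_bigr _ (fun j _ => qE j)) IHN -mulr_sumr.
have -> : p / (2 * d%:R) * (2 * \sum_i c i) = p / d%:R * \sum_i c i.
  by rewrite invfM; lra.
by rewrite -[N.+1]addn1 natrD; ring.
Qed.

Lemma even_subadditive_mulrz (V : zmodType) (b : V -> R) :
  b 0 = 0 -> (forall x, b (- x) = b x) -> (forall x y, b (x + y) <= b x + b y) ->
  forall x z, b (x *~ z) <= `|z%:~R| * b x.
Proof.
move=> b0 bN bD x z.
have bM n : b (x *+ n) <= n%:R * b x.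
  elim: n => [|n IHn]; first by rewrite mulr0n b0 mul0r.
  rewrite mulrS; apply: le_trans (bD _ _) _.
  by rewrite -[n.+1]addn1 natrD; lra.
case: (intP z) => [|n|n].
- by rewrite !mulr0z b0 normr0 mul0r.
- by rewrite -!pmulrn normr_nat.
- by rewrite mulrNz bN rmorphN normrN /= -!pmulrn normr_nat.
Qed.

(* Lift the walk to [Z^d]: after [N] steps the [j]-th coordinate [k j] has
   variance [N p / d], and [`|k j| <= (k j ^ 2 / a + a) / 2]. *)
Lemma iter_lazy_step_subadditive (V : zmodType) d (e : 'I_d -> V) p N a (b : V -> R) :
  0 <= p <= 1 -> 0 < a ->
  b 0 = 0 -> (forall x, b (- x) = b x) -> (forall x y, b (x + y) <= b x + b y) ->
  iter N (lazy_step e p) b 0 <=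
  (N%:R * (p / d%:R) / a + a) / 2 * \sum_j b (e j).
Proof.
move=> p01 a0 b0 bN bD.
have b_ge0 x : 0 <= b x by have := bD x (- x); rewrite subrr b0 bN; lra.
pose f (k : {ffun 'I_d -> int}) := \sum_j e j *~ k j.
have f_add : zmod_morphism f.
  move=> k k'; rewrite /f -sumrB; apply: eq_bigr => j _.
  by rewrite !ffunE mulrzBr.
pose F : {additive {ffun 'I_d -> int} -> V} :=
  HB.pack f (GRing.isZmodMorphism.Build _ _ f f_add).
pose delta (j : 'I_d) : {ffun 'I_d -> int} := [ffun i => (i == j)%:Z].
have Fdelta : F \o delta = e.
  apply/funext => j; rewrite /= /f (bigD1 j) //= big1 => [|i /negPf ij].
    by rewrite ffunE eqxx addr0.
  by rewrite ffunE ij.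
have -> : (0 : V) = F 0 by rewrite raddf0.
rewrite -Fdelta -iter_lazy_step_comp.
(* By monotonicity [b] may be replaced by a quadratic majorant in the [k j], whose average is known
   exactly. *)
apply: (@le_trans _ _ (iter N (lazy_step delta p)
  (fun k => \sum_j (b (e j) / (2 * a)) * (k j)%:~R ^+ 2
            + \sum_j b (e j) * (a / 2)) 0)).
  apply: iter_lazy_step_le => // k; rewrite /= -big_split /=.
  apply: (@le_trans _ _ (\sum_j b (e j *~ k j))).
    rewrite /f; elim/big_rec2: _ => [|j u v _ le_uv]; first by rewrite b0.
    by apply: le_trans (bD _ _) _; rewrite lerD2l.
  apply: ler_sum => j _; apply: le_trans (even_subadditive_mulrz b0 bN bD _ _) _.
  rewrite mulrC -mulrA -mulrDr; apply: ler_wpM2l => //.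
  rewrite invfM -(real_normK (num_real (k j)%:~R)).
  set m := `|_|; have := sqr_ge0 (m - a).
  have -> : 2^-1 * a^-1 * m ^+ 2 + a / 2 = (m ^+ 2 + a ^+ 2) / (2 * a).
    by field; lra.
  by rewrite ler_pdivlMr; nra.
rewrite iter_lazy_step_sqr big1 => [|j _]; last by rewrite ffunE expr0n mulr0.
rewrite add0r -!mulr_suml Fdelta invfM.
rewrite le_eqVlt; apply/orP; left; apply/eqP; ring.
Qed.

End LazyWalk.

(** * The walk and the Laplacian of a Cayley graph *)

Section CayleyGraph.
Variables (R : realType) (G : finZmodType) (S : seq G).
Hypotheses (symS : symmetric_mset S) (d_gt0 : (0 < deg S)%N).

Local Notation d := (deg S).

Definition generator (j : 'I_d) : G := nth 0 S j.

Definition vec_of (h : G -> R) : 'rV[R]_#|G| := \row_i h (enum_val i).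

Lemma sum_generator (F : G -> R) : \sum_(s <- S) F s = \sum_j F (generator j).
Proof. by rewrite (big_nth 0) big_mkord. Qed.

Lemma sum_generatorN (F : G -> R) : \sum_j F (- generator j) = \sum_j F (generator j).
Proof.
rewrite -(sum_generator (F \o -%R)) -sum_generator /= -(big_map -%R xpredT F).
apply: perm_big; apply/allP => x _; rewrite /= symS.
by rewrite -{1}[x]opprK count_map; apply/eqP/eq_count => y /=; rewrite eqr_opp.
Qed.

Lemma sum_enum_val (F : G -> R) : \sum_(i < #|G|) F (enum_val i) = \sum_g F g.
Proof. by rewrite [RHS](reindex _ (onW_bij _ (@enum_val_bij G))). Qed.

(** A row vector times the matrix sums over the points [x - s]; symmetry of [S] turns these into
    [x + s]. *)
Lemma vec_of_mul_nadjmx (h : G -> R) :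
  vec_of h *m nadjmx R S =
  vec_of (fun x => d%:R^-1 * \sum_j h (x + generator j)).
Proof.
apply/rowP => i; rewrite -scalemxAr !mxE; congr (_ * _).
under eq_bigr => k _ do rewrite !mxE.
rewrite (sum_enum_val (fun g => h g * (count (fun s => g + s == enum_val i) S)%:R)).
rewrite -(sum_generatorN (fun s => h (enum_val i + s))) -(sum_generator (fun s => h (enum_val i - s))).
under eq_bigr => g _ do rewrite -sum1_count natr_sum big_mkcond mulr_sumr.
rewrite exchange_big /=; apply: eq_bigr => s _.
rewrite (bigD1 (enum_val i - s)) //= subrK eqxx mulr1 big1 ?addr0 // => g.
by move=> g_ne; rewrite eq_sym -subr_eq eq_sym (negPf g_ne) mulr0.
Qed.

(** By symmetry the two halves of a lazy step agree, which absorbs the 2 in [2 * d]. *)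
Lemma vec_of_lazy_step p (h : G -> R) :
  vec_of h - p *: (vec_of h *m nlapmx R S) = vec_of (lazy_step generator p h).
Proof.
rewrite /nlapmx mulmxBr mulmx1 vec_of_mul_nadjmx.
apply/rowP => i; rewrite !mxE /lazy_step; set x := enum_val i.
have dn0 : d%:R != 0 :> R by rewrite pnatr_eq0 -lt0n.
rewrite sumrB big_split /= (sum_generatorN (fun s => h (x + s))).
rewrite sumr_const card_ord -mulr_natr.
by field.
Qed.

Lemma iter_lazy_step_vec_of p N (h : G -> R) :
  iter N (fun y => y - p *: (y *m nlapmx R S)) (vec_of h) =
  vec_of (iter N (lazy_step generator p) h).
Proof. by elim: N => //= N ->; rewrite vec_of_lazy_step. Qed.

Lemma nlapmx_sym : (nlapmx R S)^T = nlapmx R S.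
Proof.
apply/matrixP => i j; rewrite !mxE eq_sym; congr (_ - _ * _%:R).
have countE (x y : G) : count (fun s => x + s == y) S = count_mem (y - x) S.
  by apply: eq_count => s /=; rewrite addrC eq_sym -subr_eq eq_sym.
by rewrite !countE symS opprB.
Qed.

(* Look at an entry of the eigenvector of largest absolute value. *)
Lemma eigenvalue_nlapmx lam : eigenvalue (nlapmx R S) lam -> 0 <= lam <= 2.
Proof.
move=> /eigenvalueP[v vL v0].
pose h g := v 0 (enum_rank g).
have vE : v = vec_of h by apply/rowP => i; rewrite mxE /h enum_valK.
have hE g : (1 - lam) * h g = d%:R^-1 * \sum_j h (g + generator j).
  have := vec_of_mul_nadjmx h; rewrite -vE.
  have -> : nadjmx R S = 1%:M - nlapmx R S by rewrite /nlapmx opprB addrC subrK.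
  rewrite mulmxBr mulmx1 vL => /rowP /(_ (enum_rank g)).
  by rewrite !mxE enum_rankK => <-; rewrite /h; ring.
have [g0 g0max] : exists g0, forall g, `|h g| <= `|h g0|.
  case: (Order.TotalTheory.arg_maxP (fun g => `|h g|) (isT : xpredT (0 : G))) => g0 _ gm.
  by exists g0 => g; apply: gm.
have h0_gt0 : 0 < `|h g0|.
  rewrite lt_neqAle normr_ge0 andbT eq_sym; apply: contraNN v0 => /eqP h0.
  apply/eqP/rowP => i; rewrite vE !mxE; apply/eqP.
  by rewrite -normr_le0 -h0 g0max.
have : `|1 - lam| * `|h g0| <= 1 * `|h g0|.
  rewrite -normrM hE normrM mul1r normfV normr_nat ler_pdivrMl ?ltr0n //.
  apply: le_trans (ler_norm_sum _ _ _) _.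
  have -> : d%:R * `|h g0| = \sum_(j < d) `|h g0|.
    by rewrite sumr_const card_ord mulr_natl.
  by apply: ler_sum => j _.
rewrite ler_pM2r // ler_norml; lra.
Qed.

End CayleyGraph.

(** * Elements leaving a set under translation *)

Section Boundary.
Variables (R : realType) (G : finZmodType) (Q : {set G}).

Definition boundary (x : G) : R := \sum_(v in Q) (v + x \notin Q)%:R.

Lemma boundary0 : boundary 0 = 0.
Proof. by rewrite /boundary big1 // => v vQ; rewrite addr0 vQ. Qed.

(** The autocorrelation of [Q] on the right makes evenness a change of variable. *)
Lemma boundaryE x : boundary x = #|Q|%:R - \sum_v ((v \in Q) && (v + x \in Q))%:R.
Proof.
rewrite -sum1_card natr_sum /boundary big_mkcond [X in X - _]big_mkcond.
rewrite -sumrB; apply: eq_bigr => v _ /=.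
by case: (v \in Q) => /=; [case: (_ \in Q) | idtac]; rewrite ?subrr ?subr0.
Qed.

Lemma boundaryN x : boundary (- x) = boundary x.
Proof.
rewrite !boundaryE; congr (_ - _).
rewrite (reindex_inj (addIr x)) /=; apply: eq_bigr => v _.
by rewrite addrK andbC.
Qed.

(** An element that leaves under [x + y] either leaves under [x] or is moved by [x] to a point of
    [Q] that leaves under [y]. *)
Lemma boundaryD x y : boundary (x + y) <= boundary x + boundary y.
Proof.
rewrite {3}/boundary big_mkcond (reindex_inj (addIr x)) /=.
rewrite /boundary big_mkcond [X in _ <= X + _]big_mkcond -big_split /=.
apply: ler_sum => v _; rewrite addrA.
by case: (v \in Q); case: (v + x \in Q); case: (_ \in Q); rewrite /= ?addr0 ?add0r ?lexx ?ler01 // lerDl.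
Qed.

Lemma boundary_sizeE (S : seq G) :
  (boundary_size S Q)%:R = \sum_(s <- S) boundary s.
Proof.
rewrite /boundary_size natr_sum exchange_big /=; apply: eq_bigr => v _.
rewrite -sum1_count natr_sum big_mkcond; apply: eq_bigr => s _.
by case: (_ \notin _).
Qed.

End Boundary.

(** * Energy of the centred indicator and its mass outside [LOW] *)

Section Cut.
Variables (R : realType) (G : finZmodType) (S : seq G) (Q : {set G}).

Local Notation ind := (fun g : G => (g \in Q)%:R : R).
Local Notation x := (center (indic R Q)).
Local Notation c := (#|Q|%:R / #|G|%:R : R).

Lemma sum_mem : \sum_g ind g = #|Q|%:R.
Proof.
by rewrite -sum1_card natr_sum [RHS]big_mkcond; apply: eq_bigr => g _; case: ifP.
Qed.

(** The shape [1 * ind g + - c] is the one that [iter_lazy_step_affine] rewrites. *)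
Lemma center_indic : center (indic R Q) = vec_of (fun g => 1 * ind g + - c).
Proof.
apply/rowP => i; rewrite /center !mxE mul1r mulr1; congr (_ - _ / _).
under eq_bigr => j _ do rewrite mxE.
by rewrite (sum_enum_val ind) sum_mem.
Qed.

Lemma sqnorm_center_indic :
  sqnorm (center (indic R Q)) = #|Q|%:R * (1 - c).
Proof.
have n0 : #|G|%:R != 0 :> R by rewrite pnatr_eq0 -lt0n; apply/card_gt0P; exists 0.
rewrite center_indic /sqnorm; under eq_bigr => i _ do rewrite mxE.
rewrite (sum_enum_val (fun g => (1 * ind g + - c) ^+ 2)).
have -> : \sum_g (1 * ind g + - c) ^+ 2 =
    \sum_g ((1 - 2 * c) * ind g + c ^+ 2) :> R.
  by apply: eq_bigr => g _; case: (g \in Q) => /=; ring.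
rewrite big_split /= -mulr_sumr sum_mem sumr_const -mulr_natr.
by field.
Qed.

(** By translation the sum is the walk from 0 applied to [y |-> \sum_g h (g + y)], a constant
    function. *)
Lemma sum_iter_lazy_step d (e : 'I_d -> G) p N (h : G -> R) :
  \sum_g iter N (lazy_step e p) h g = \sum_g h g.
Proof.
transitivity (\sum_g iter N (lazy_step e p) (fun y => h (g + y)) 0).
  by apply: eq_bigr => g _; rewrite iter_lazy_step_shift addr0.
rewrite -iter_lazy_step_sum.
have -> : (fun y => \sum_g h (g + y)) = (fun y => 0 * h y + \sum_g h g).
  apply/funext => y; rewrite mul0r add0r.
  by rewrite [RHS](reindex_inj (addIr y)).
by rewrite iter_lazy_step_affine mul0r add0r.
Qed.

(** The energy equals the [N]-step average of [boundary] from 0: conservation of the sum removes the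
    centring constant. *)
Lemma lazy_walk_energy (p a : R) N :
  symmetric_mset S -> (0 < deg S)%N -> 0 <= p <= 1 -> 0 < a ->
  ((x - iter N (fun y => y - p *: (y *m nlapmx R S)) x) *m x^T) 0 0 <=
  (N%:R * (p / (deg S)%:R) / a + a) / 2 * (boundary_size S Q)%:R :> R.
Proof.
move=> symS d_gt0 p01 a0.
rewrite boundary_sizeE sum_generator.
have := iter_lazy_step_subadditive (@generator G S) N p01 a0 (boundary0 R Q)
  (boundaryN R Q) (boundaryD R Q).
apply: le_trans; rewrite le_eqVlt; apply/orP; left; apply/eqP.
rewrite center_indic iter_lazy_step_vec_of // iter_lazy_step_affine.
set u := iter N _ ind.
rewrite mxE; under eq_bigr => i _ do rewrite !mxE.
rewrite (sum_enum_val (fun g => (1 * ind g + - c - (1 * u g + - c)) * (1 * ind g + - c))).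
transitivity (\sum_g (ind g - u g) * ind g - c * (\sum_g ind g - \sum_g u g)).
  rewrite -sumrB mulr_sumr -sumrB; apply: eq_bigr => g _; ring.
rewrite /u sum_iter_lazy_step subrr mulr0 subr0.
have -> : @boundary R G Q =
    fun y => \sum_(g in Q) (fun y => -1 * ind (g + y) + 1) y.
  apply/funext => y; apply: eq_bigr => g _.
  by case: (_ \in Q); rewrite /=; ring.
rewrite iter_lazy_step_sum [RHS]big_mkcond; apply: eq_bigr => g _ /=.
rewrite iter_lazy_step_affine (iter_lazy_step_shift _ _ _ ind) addr0.
by case: (g \in Q); rewrite /=; ring.
Qed.

(** Here [t] is the total time [N p], and [a] is the free parameter of the variance bound. *)
Lemma low_mass (tau t a : R) :
  symmetric_mset S -> (0 < deg S)%N -> 0 < t -> 0 < a ->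
  (forall lam, eigenvalue (nlapmx R S) lam -> tau < lam -> 1 <= t * lam) ->
  sqnorm x - sqnorm (orth_proj (LOW S tau) x) <=
  (t / (deg S)%:R / a + a) * (boundary_size S Q)%:R.
Proof.
move=> symS d_gt0 t0 a0 high.
have rhs_ge0 : 0 <= (t / (deg S)%:R / a + a) * (boundary_size S Q)%:R :> R.
  by rewrite mulr_ge0 // addr_ge0 ?divr_ge0 ?(ltW t0) ?(ltW a0).
rewrite /LOW; case: ifP => _.
  apply: le_trans (orth_proj_dist x (submx1 x)) _.
  suff -> : sqnorm (x - x) = 0 by [].
  by rewrite subrr /sqnorm big1 // => i _; rewrite mxE expr0n.
(* [N > 2 t] makes [p < 1/2], so [p lam <= 1] because [lam <= 2]. *)
pose N := (Num.bound (2 * t)).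
have N2t : 2 * t < N%:R by apply: archi_boundP; lra.
have N0 : N%:R != 0 :> R by lra.
pose p := t / N%:R.
have Np : N%:R * p = t by rewrite mulrC divfK.
have p01 : 0 <= p <= 1 by nra.
have := lazy_walk_energy N symS d_gt0 p01 a0; rewrite mulrA Np => energy.
have := @low_eigenspaces_dist R _ (nlapmx R S) tau p N x (nlapmx_sym R symS).
move=> /(_ _)/le_trans; apply; last by nra.
move=> lam eiglam; have /andP[lam0 lam2] := eigenvalue_nlapmx symS d_gt0 eiglam.
split; [by nra|by nra|move=> /(high _ eiglam)].
by rewrite -mulr_natl mulrA Np.
Qed.

End Cut.

(** * Choice of the time [t] and the parameter [a] *)

Theorem theorem5p1 (R : realType) (G : finZmodType) (S : seq G)
  (eps : R) (Q : {set G}) :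
  symmetric_mset S ->
  (0 < deg S)%N ->
  0 < eps -> eps <= 1 ->
  admissible Q ->
  cond_set R S Q <= 2 * conductance R S ->
  let tau := 100 * (deg S)%:R * conductance R S ^+ 2 / eps ^+ 2 in
  sqnorm (orth_proj (LOW S tau) (center (indic R Q)))
    >= (1 - eps) * sqnorm (center (indic R Q)).
Proof.
move=> symS d_gt0 eps0 eps1 /andP[Q1 Qn] condQ.
set phi := conductance R S in condQ *; set tau := _ / _; move=> /=.
set x := center _; set d : R := (deg S)%:R in tau *.
have d0 : 0 < d by rewrite ltr0n.
have q0 : 0 < #|Q|%:R :> R by rewrite ltr0n.
have n0 : 0 < #|G|%:R :> R by rewrite ltr0n; apply/card_gt0P; exists 0.
(* [|x|^2 = |Q| (1 - |Q|/n)] and [|Q| <= n/2]. *)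
have Mge : #|Q|%:R <= 2 * sqnorm x.
  have c_le : #|Q|%:R / #|G|%:R <= 2^-1 :> R.
    rewrite ler_pdivrMr // mulrC ler_pdivlMr // mulrC -natrM ler_nat //.
  by rewrite sqnorm_center_indic; nra.
have bQ : (boundary_size S Q)%:R <= 2 * phi * (d * #|Q|%:R).
  by move: condQ; rewrite /cond_set natrM ler_pdivrMr // mulr_gt0.
have b0 : 0 <= (boundary_size S Q)%:R :> R by [].
have phi0 : 0 <= phi.
  have dq : 0 < d * #|Q|%:R by rewrite mulr_gt0.
  rewrite leNgt; apply/negP => ?; nra.
suff : sqnorm x - sqnorm (orth_proj (LOW S tau) x) <= eps * sqnorm x by lra.
have [phi_eq0|phi_neq0] := eqVneq phi 0.
  have bQ0 : (boundary_size S Q)%:R = 0 :> R by rewrite phi_eq0 in bQ; lra.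
  (* Now [tau = 0] and [Q] has empty boundary, so any [t] with [t lam >= 1] at all positive
     eigenvalues will do. The sum dominates each [1 / lam], and the added 1 keeps [t] positive. *)
  set L := nlapmx R S; pose sum_inv := \sum_(mu <- rootsR (char_poly L)) `|mu^-1|.
  have sum_inv0 : 0 <= sum_inv by apply: sumr_ge0.
  have t0 : 0 < 1 + sum_inv by lra.
  apply: le_trans (low_mass Q symS d_gt0 t0 ltr01 _) _; last first.
    by rewrite bQ0 mulr0 mulr_ge0 ?sqnorm_ge0 ?ltW.
  move=> lam; rewrite eigenvalue_root_char => lam_root.
  rewrite /tau phi_eq0 expr0n mulr0 mul0r => lam0.
  rewrite -ler_pdivrMr // mul1r; apply: (@le_trans _ _ sum_inv); last by lra.
  have lam_rs : lam \in rootsR (char_poly L).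
    have := roots_on_rootsR (monic_neq0 (char_poly_monic L)) lam.
    by rewrite in_itv /= => <-.
  rewrite /sum_inv (bigD1_seq lam) ?uniq_roots //= ger0_norm ?invr_ge0 ?(ltW lam0) //.
  by rewrite lerDl sumr_ge0.
have phi_gt0 : 0 < phi by rewrite lt_neqAle eq_sym phi_neq0.
have tau0 : 0 < tau by rewrite divr_gt0 ?mulr_gt0 ?exprn_gt0.
(* With [t = 1 / tau], this is [sqrt (t / d)], the minimiser of [t / (d a) + a]. *)
pose a := eps / (10 * d * phi).
have a0 : 0 < a by rewrite divr_gt0 ?mulr_gt0.
have taud : tau^-1 / d / a = a by rewrite /tau /a; field; lra.
apply: le_trans (low_mass Q symS d_gt0 (t := tau^-1) _ a0 _) _.
- by rewrite invr_gt0.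
- by move=> lam _ lt_lam; rewrite mulrC ler_pdivlMr // mul1r ltW.
rewrite -/d taud.
apply: (@le_trans _ _ ((a + a) * (2 * phi * (d * #|Q|%:R)))).
  by rewrite ler_wpM2l // addr_ge0 // ltW.
(* As [|Q| <= 2 |x|^2], this is at most [4/5 eps |x|^2]. *)
have -> : (a + a) * (2 * phi * (d * #|Q|%:R)) = 2 / 5 * (eps * #|Q|%:R).
  by rewrite /a; field; rewrite !gt_eqF.
nra.
Qed.
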